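(* Let $n\geq 1$, $d>1$ be integers and put $t_{n,d}=\frac{d}{n+1}$. (1) Suppose $d\leq n+2$ (so that hypersurfaces of degree $d$ in $\mathbb P^{n+1}$ are Fano or Calabi–Yau) and let $t\in\mathbb Q_{>0}$. Then every point of the GIT quotient $\overline M^{GIT}_{n,d,t}$ parametrizes a closed orbit associated to a pair $(X,D)$ with $D=X\cap H$; that is, the corresponding pair $(X,H)$ satisfies $H\not\subset \mathrm{Supp}(X)$, so that $D=X\cap H$ is a hyperplane section of $X$. (2) Suppose $d\leq n+1$ (so that $X$ is Fano), let $t\in\mathbb Q_{\geq 0}$ with $t\leq t_{n,d}$, and let $(X,H)$ be a $t$-semistable pair. Then $X$ does not contain a hyperplane in its support, unless $t=t_{n,d}$, in which case (i.e. if $t=t_{n,d}$ and $X$ contains a hyperplane in its support) $(X,H)$ is strictly $t_{n,d}$-semistable.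
   Context: $\mathbb K$ is an algebraically closed field, $G=\mathrm{SL}(n+2,\mathbb K)$ acts on $\mathbb P^{n+1}$ with fixed homogeneous coordinates $x_0,\dots,x_{n+1}$. A pair $(X,H)$ consists of a (possibly singular or reducible) hypersurface $X\subset\mathbb P^{n+1}$ of degree $d$ (zero scheme of a nonzero form $F=\sum c_Ix^I$) and a hyperplane $H=\{\sum h_ix_i=0\}$; one also writes $(X,D)$ with $D=X\cap H$, and stability of $(X,D)$ means that of $(X,H)$. The hypersurface is Fano if $d\leq n+1$ and Calabi–Yau if $d=n+2$. The parameter space of pairs is $\mathcal R=\mathbb P(H^0(\mathbb P^{n+1},\mathcal O(d)))\times\mathbb P(H^0(\mathbb P^{n+1},\mathcal O(1)))$ with projections $\pi_1,\pi_2$. For integers $a,b>0$ with $t=b/a$, let $\mathcal L=\pi_1^*\mathcal O(a)\otimes\pi_2^*\mathcal O(b)$ with its unique $G$-linearization and $\overline M^{GIT}_{n,d,t}=\mathrm{Proj}\bigoplus_{m\geq0}H^0(\mathcal R,\mathcal L^{\otimes m})^G$; its points correspond to the $G$-orbits of $t$-semistable pairs which are closed in the $t$-semistable locus. Stability: for a normalized one-parameter subgroup $\lambda(s)=\mathrm{Diag}(s^{r_0},\ldots,s^{r_{n+1}})$ ($r_i\in\mathbb Z$, $r_0\geq\cdots\geq r_{n+1}$, $\sum r_i=0$, not all zero), put $\mu_t(X,H,\lambda)=\min\{\sum_i d_ir_i\mid c_{(d_0,\ldots,d_{n+1})}\neq0\}+t\min\{r_i\mid h_i\neq0\}$. The pair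 is $t$-stable (resp. $t$-semistable) if $\mu_t(g\cdot X,g\cdot H,\lambda)<0$ (resp. $\leq 0$) for all $g\in G$ and all normalized $\lambda$; it is strictly $t$-semistable if it is $t$-semistable but not $t$-stable. *)

(* Defs.v *)
From HB Require Import structures.
From mathcomp Require Import all_boot all_order all_algebra.
From mathcomp Require Import mpoly.

Set Implicit Arguments.
Unset Strict Implicit.
Unset Printing Implicit Defensive.

Import Order.TTheory GRing.Theory Num.Theory.
Local Open Scope ring_scope.

(* [dhomog n.+2 K d] is the space of forms of degree d in x_0, ..., x_{n+1},
   i.e. H^0(P^{n+1}, O(d)).  A [hpair] is a representative of a point of
   P(H^0(O(d))) x P(H^0(O(1))): both forms matter only up to nonzero scalars. *)
Record hpair (K : closedFieldType) (n d : nat) := HPair {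
  eqX : dhomog n.+2 K d;
  eqH : dhomog n.+2 K 1;
  eqX_neq0 : eqX != 0;
  eqH_neq0 : eqH != 0
}.

Section Hypersurfaces.
Variables (K : closedFieldType) (n : nat).
Implicit Types F L : {mpoly K[n.+2]}.

(* The set of (closed) points of {F = 0} in P^{n+1}, in homogeneous
   coordinates; multiplicities are forgotten. *)
Definition Supp F (x : 'cV[K]_n.+2) : Prop :=
  x != 0 /\ F.@[fun i => x i 0] = 0.

Definition sub_Supp L F : Prop := forall x, Supp L x -> Supp F x.

Definition contains_hyperplane F : Prop :=
  exists2 L : dhomog n.+2 K 1, L != 0 & sub_Supp L F.

(* (g . F)(x) = F(g^-1 x), the equation of the image of {F = 0} by x |-> g x. *)
Definition act (g : 'M[K]_n.+2) F : {mpoly K[n.+2]} :=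
  F \mPo [tuple \sum_j invmx g i j *: 'X_j | i < n.+2].

Definition in_SL (g : 'M[K]_n.+2) : Prop := \det g = 1.

End Hypersurfaces.

Section Stability.
Variables (K : closedFieldType) (n : nat).
Implicit Types (F L : {mpoly K[n.+2]}) (r : 'I_n.+2 -> int).

(* The weights r of the one-parameter subgroup Diag(s^r_0, ..., s^r_{n+1}). *)
Definition normalized_1ps r : Prop :=
  [/\ forall i j : 'I_n.+2, (i <= j)%N -> r j <= r i,
      \sum_i r i = 0
    & exists i, r i != 0].

Definition weight r (m : 'X_{1..n.+2}) : int := \sum_i (m i)%:Z * r i.

(* Minimum over the monomials occurring in F; for F != 0, [mlead F] is one of
   them, so the initial value of the iterated min is harmless.  For a linear
   form L = \sum_i h_i x_i this is min {r_i | h_i != 0}. *)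
Definition min_weight r F : int :=
  \big[Num.min/weight r (mlead F)]_(m <- msupp F) weight r m.

Definition mu (t : rat) F L r : rat :=
  (min_weight r F)%:~R + t * (min_weight r L)%:~R.

Variable d : nat.
Implicit Types p q : hpair K n d.

Definition stable (t : rat) p : Prop :=
  forall g r, in_SL g -> normalized_1ps r ->
    mu t (act g (eqX p)) (act g (eqH p)) r < 0.

Definition semistable (t : rat) p : Prop :=
  forall g r, in_SL g -> normalized_1ps r ->
    mu t (act g (eqX p)) (act g (eqH p)) r <= 0.

Definition strictly_semistable (t : rat) p : Prop :=
  semistable t p /\ ~ stable t p.

End Stability.

Section Quotient.
Variables (K : closedFieldType) (n d : nat).
Implicit Types p q : hpair K n d.

(* Subsets of the parameter space are predicates on representatives; the orbit
   is taken in the product of projective spaces, hence the scalars a and b. *)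
Definition orbit p q : Prop :=
  exists g a b, [/\ in_SL g, a != 0 /\ b != 0,
    mpoly_of_dhomog (eqX q) = a *: act g (eqX p)
  & mpoly_of_dhomog (eqH q) = b *: act g (eqH p)].

(* Homogeneous coordinates (c_I, h_i) on the parameter space: the c_I are
   indexed by the monomials I of degree d. *)
Definition dmonom := {m : 'X_{1..n.+2 < d.+1} | mdeg m == d}.

Definition coords p (k : 'I_(#|{: dmonom}| + n.+2)) : K :=
  match split k with
  | inl i => (eqX p)@_(val (val (@enum_val dmonom predT i)))
  | inr i => (eqH p)@_(U_(i))
  end.

Definition bihomog (P : {mpoly K[#|{: dmonom}| + n.+2]}) : Prop :=
  exists u v : nat, forall m, m \in msupp P ->
    (\sum_i m (lshift n.+2 i) = u)%N /\ (\sum_i m (rshift #|{: dmonom}| i) = v)%N.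

Definition zariski_closed (Z : hpair K n d -> Prop) : Prop :=
  exists2 S : {mpoly K[#|{: dmonom}| + n.+2]} -> Prop,
    forall P, S P -> bihomog P &
    forall p, Z p <-> forall P, S P -> P.@[coords p] = 0.

Definition closed_in (U A : hpair K n d -> Prop) : Prop :=
  exists2 Z, zariski_closed Z & forall p, A p <-> U p /\ Z p.

(* The points of the GIT quotient of parameter t: the orbits of t-semistable
   pairs that are closed in the t-semistable locus. *)
Definition GIT_quotient (t : rat) (O : hpair K n d -> Prop) : Prop :=
  exists p, [/\ semistable t p,
                forall q, O q <-> orbit p q
              & closed_in (semistable t) O].

End Quotient.

Definition t_crit (n d : nat) : rat := d%:R / n.+1%:R.

(* Main.v *)
Require Import Defs.
From mathcomp Require Import all_boot all_order all_algebra.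
From mathcomp Require Import mpoly.
From mathcomp Require Import zify ring.
Import Order.TTheory GRing.Theory Num.Theory.
Local Open Scope ring_scope.

(** Both parts come from a single one-parameter subgroup.  Suppose that X
    contains a hyperplane.  After a change of coordinates in SL the hyperplane
    is x_0 = 0, so every monomial of the equation of X is divisible by x_0.
    Give x_0 the weight n + 1 and every other coordinate the weight -1.  A
    monomial of degree d with exponent m_0 of x_0 has weight
    m_0 (n + 2) - d, so the minimal weight of X is at least n + 2 - d.

    If the hyperplane is H itself, then H has weight n + 1 and
      mu_t >= (n + 2 - d) + t (n + 1) > 0   when d <= n + 2 and t > 0,
    so (X, H) is not semistable ([semistable_not_sub_Supp]).  For the GIT
    quotient it remains to see that the inclusion of H in Supp X is constant
    along orbits ([orbit_sub_Supp]).

    For an arbitrary hyperplane in X, the weight of H is at least -1, so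
      mu_t >= n + 2 - d - t >= n + 2 - d - d / (n + 1)
            = (n + 2) (n + 1 - d) / (n + 1) >= 0
    when d <= n + 1 and t <= d / (n + 1)
    ([contains_hyperplane_mu], [fano_weight_bound]).  The middle inequality is
    strict when t < d / (n + 1), which contradicts semistability; when
    t = d / (n + 1), mu_t >= 0 still contradicts stability.

    Supports are sets of points, so passing from vanishing on x_0 = 0 to
    divisibility of monomials by x_0 needs the fact that a polynomial vanishing
    on a coordinate subspace over an infinite field has no monomial in the
    coordinates of that subspace ([msupp_meets_zeros]). *)

Set Implicit Arguments.
Unset Strict Implicit.

(** * Polynomials vanishing on coordinate subspaces *)

Lemma digits_inj (B k : nat) (a b : 'I_k -> nat) :
  (forall i, a i < B)%N -> (forall i, b i < B)%N ->
  (\sum_i a i * B ^ i)%N = (\sum_i b i * B ^ i)%N -> a =1 b.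
Proof.
elim: k a b => [|k IHk] a b ltaB ltbB; first by move=> _ [].
have split0 (c : 'I_k.+1 -> nat) : (\sum_i c i * B ^ i)%N =
    (c ord0 + B * \sum_i c (lift ord0 i) * B ^ i)%N.
  rewrite big_ord_recl expn0 muln1 big_distrr /=; congr (_ + _)%N.
  by apply: eq_bigr => i _; rewrite /bump /= add1n expnS mulnCA.
have B_gt0 : (0 < B)%N by apply: leq_trans (ltaB ord0).
rewrite !split0 => eqab.
have eq0 : a ord0 = b ord0.
  have := congr1 (modn^~ B) eqab.
  by rewrite /= ![(_ + B * _)%N]addnC ![(B * _)%N]mulnC !modnMDl !modn_small.
have eqS : (fun i => a (lift ord0 i)) =1 (fun i => b (lift ord0 i)).
  apply: IHk => [i|i|]; [exact: ltaB | exact: ltbB |].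
  by move/eqP: eqab; rewrite eq0 eqn_add2l eqn_pmul2l // => /eqP.
by move=> i; case: (unliftP ord0 i) => [j|] ->; [exact: eqS|].
Qed.

(** Kronecker substitution: evaluate F at x_i = s ^ (B ^ i) for i outside S and
    x_i = 0 for i in S, where B exceeds all exponents.  Uniqueness of base-B
    digits keeps the monomials free of S apart, so if there were one, the
    result would be a nonzero polynomial in s with every s as a root. *)
Lemma msupp_meets_zeros (K : closedFieldType) (k : nat) (F : {mpoly K[k]})
    (S : pred 'I_k) :
  (forall x, (forall i, S i -> x i = 0) -> F.@[x] = 0) ->
  forall m, m \in msupp F -> exists2 i, S i & m i != 0%N.
Proof.
move=> F0 m mF.
pose out (m' : 'X_{1..k}) := [forall i, S i ==> (m' i == 0%N)].
suff: ~~ out m.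
  by case/forallPn=> i; rewrite negb_imply => /andP[Si mi]; exists i.
apply/negP=> outm.
pose B := msize F; pose e (m' : 'X_{1..k}) := (\sum_i m' i * B ^ i)%N.
pose Q : {poly K} := \sum_(m' <- msupp F | out m') F@_m' *: 'X^(e m').
have ltB m' : m' \in msupp F -> forall i, (m' i < B)%N.
  move=> m'F i; apply: leq_ltn_trans (msize_mdeg_lt m'F).
  by rewrite mdegE (bigD1 i) //= leq_addr.
have Qe : Q`_(e m) = F@_m.
  rewrite coef_sum big_mkcond (bigD1_seq m) ?msupp_uniq //= outm.
  rewrite coefZ coefXn eqxx mulr1 big_seq_cond.
  rewrite big1 ?addr0 // => m' /andP[m'F ne_m'm]; case: ifP => // _.
  rewrite coefZ coefXn; case: eqP => [eq_e|]; last by rewrite mulr0.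
  case/eqP: ne_m'm; apply/mnmP.
  by apply: (@digits_inj B) => //; [exact: ltB | exact: ltB].
have /closed_nonrootP[s] : Q != 0.
  apply: contraTneq mF => Q0; rewrite mcoeff_msupp negbK.
  by rewrite -Qe Q0 coef0.
case/negP; apply/rootP.
rewrite -(F0 (fun i => if S i then 0 else s ^+ (B ^ i))); last first.
  by move=> i ->.
rewrite mevalE horner_sum big_mkcond /=; apply: eq_bigr => m' _.
case: ifPn => [outm' | /forallPn[i]].
  rewrite hornerZ hornerXn; congr (_ * _).
  rewrite /e expr_sum; apply: eq_bigr => i _; rewrite mulnC exprM.
  by case: ifP => // Si; have /forallP/(_ i) := outm'; rewrite Si => /eqP->.
rewrite negb_imply => /andP[Si m'i].
by rewrite (bigD1 i) //= Si expr0n (negPf m'i) mul0r mulr0.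
Qed.

Lemma meval_eq0_mpoly (K : closedFieldType) (k : nat) (F : {mpoly K[k]}) :
  (forall x, F.@[x] = 0) -> F = 0.
Proof.
move=> F0; apply/mpolyP => m; rewrite mcoeff0; apply/eqP.
rewrite mcoeff_eq0; apply/negP.
by case/(@msupp_meets_zeros _ _ _ pred0 (fun x _ => F0 x)).
Qed.

(** * The action of SL on forms *)

Section Action.
Variables (K : closedFieldType) (n : nat).
Implicit Types (F L : {mpoly K[n.+2]}) (g : 'M[K]_n.+2) (x : 'cV[K]_n.+2).

Lemma meval_act g F x :
  (act g F).@[fun i => x i 0] = F.@[fun i => (invmx g *m x) i 0].
Proof.
rewrite comp_mpoly_meval; apply: meval_eq => i.
rewrite tnth_mktuple raddf_sum mxE /=; apply: eq_bigr => j _.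
by rewrite mevalZ mevalXU.
Qed.

Lemma in_SL_unit g : in_SL g -> g \in unitmx.
Proof. by rewrite unitmxE /in_SL => ->; rewrite unitr1. Qed.

Lemma meval_act_mul g F x : in_SL g ->
  (act g F).@[fun i => (g *m x) i 0] = F.@[fun i => x i 0].
Proof. by move=> /in_SL_unit gU; rewrite meval_act mulKmx. Qed.

Lemma act_eq0 g F : in_SL g -> act g F = 0 -> F = 0.
Proof.
move=> gSL gF0; apply: meval_eq0_mpoly => x.
have -> : F.@[x] = F.@[fun i => (\col_j x j) i 0].
  by apply: meval_eq => i; rewrite mxE.
by rewrite -(meval_act_mul _ _ gSL) gF0 meval0.
Qed.

Lemma act_homog g F d : F \is d.-homog -> act g F \is d.-homog.
Proof.
move=> /dhomogP Fd; rewrite /act comp_mpolyE big_seq.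
apply: rpred_sum => m /Fd /= <-; apply: rpredZ; rewrite mdegE.
elim/big_ind2: _ => [|p1 d1 p2 d2 hom1 hom2|i _]; first exact: dhomog1.
  exact: dhomogM.
rewrite tnth_mktuple; set l := \sum_j _.
suff /(dhomogMn (m i)) : l \is 1.-homog by rewrite mul1n.
by apply: rpred_sum => j _; apply: rpredZ; rewrite dhomogX /= mdeg1.
Qed.

Lemma sub_Supp_act g L F :
  in_SL g -> sub_Supp (act g L) (act g F) -> sub_Supp L F.
Proof.
move=> gSL sLF x [x0 Lx]; split=> //; rewrite -(meval_act_mul _ _ gSL).
case: (sLF (g *m x)) => //; split; last by rewrite meval_act_mul.
by apply: contraNneq x0 => gx0; rewrite -(mulKmx (in_SL_unit gSL) x) gx0 mulmx0.
Qed.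

Lemma sub_SuppZ a b L F : a != 0 ->
  sub_Supp (b *: L) (a *: F) -> sub_Supp L F.
Proof.
move=> a0 sLF x [x0 Lx]; split=> //; case: (sLF x).
  by split=> //; rewrite mevalZ Lx mulr0.
by rewrite mevalZ => _ /eqP; rewrite mulf_eq0 (negPf a0) => /eqP.
Qed.

(** The coefficient row turns a linear form into a matrix, so that a hyperplane
    can be moved by matrix algebra. *)
Lemma meval_linear L x : L \is 1.-homog ->
  L.@[fun i => x i 0] = ((\row_i L@_(U_(i))) *m x) 0 0.
Proof.
move=> /dhomogP L1.
have eqL : L = \sum_i L@_(U_(i)) *: 'X_i.
  apply/mpolyP => m; rewrite raddf_sum /=.
  have [/mdeg1P[j /eqP->]|mN1] := boolP (mdeg m == 1%N).
    rewrite (bigD1 j) //= mcoeffZ mcoeffX eqxx mulr1 big1 ?addr0 // => i ij.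
    rewrite mcoeffZ mcoeffX; case: eqP => [/mnmP/(_ i)|]; last by rewrite mulr0.
    by rewrite !mnm1E eqxx eq_sym (negPf ij).
  rewrite (_ : L@_m = 0); last first.
    by apply/eqP; rewrite mcoeff_eq0; apply: contraNN mN1 => /L1/= ->.
  rewrite big1 // => i _; rewrite mcoeffZ mcoeffX; case: eqP => [eqm|].
    by rewrite -eqm mdeg1 in mN1.
  by rewrite mulr0.
rewrite [in LHS]eqL raddf_sum mxE /=; apply: eq_bigr => i _.
by rewrite mevalZ mevalXU mxE.
Qed.

(** Gaussian elimination writes a as u *m R with R invertible and u supported on
    its first entry.  Rescaling the last row of R, which is not its first since
    the size is at least 2, makes the determinant 1. *)
Lemma exists_SL_first_row (a : 'rV[K]_n.+2) :
  exists2 g, in_SL g & exists c, a = c *: row 0 g.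
Proof.
set R := row_ebase a; have /= eqa := mulmx_ebase a.
pose D : 'M[K]_n.+2 :=
  diag_mx (\row_i if i == ord_max then (\det R)^-1 else 1).
exists (D *m R).
  rewrite /in_SL det_mulmx det_diag big_ord_recr /= mxE eqxx big1 ?mul1r.
    by rewrite mulVf // -unitfE -unitmxE row_ebase_unit.
  by move=> i _; rewrite mxE -val_eqE /= ltn_eqF.
set u := col_ebase a *m _ in eqa; exists (u 0 0).
rewrite row_mul scalemxAl -eqa; congr (_ *m _); apply/rowP => j.
rewrite !mxE !big_ord1 !mxE -!val_eqE /=.
by case: eqP => _; rewrite ?mulr1 ?mulr0.
Qed.

(** If g has the coefficient row of L as first row up to a scalar, then
    L (g^-1 x) is a multiple of x_0. *)
Lemma exists_SL_straighten L : L \is 1.-homog ->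
  exists2 g, in_SL g &
    forall x, x 0 0 = 0 -> L.@[fun i => (invmx g *m x) i 0] = 0.
Proof.
move=> L1; have [g gSL [c Lg]] := exists_SL_first_row (\row_i L@_(U_(i))).
exists g => // x x0.
rewrite meval_linear // Lg -scalemxAl -row_mul mulKVmx ?in_SL_unit //.
by rewrite !mxE x0 mulr0.
Qed.

End Action.

(** * Weights of the destabilizing one-parameter subgroup *)

Section Weights.
Variables (K : closedFieldType) (n : nat).
Implicit Types (F L : {mpoly K[n.+2]}) (r : 'I_n.+2 -> int).

Definition coord_1ps (i : 'I_n.+2) : int := if i == ord0 then n.+1%:Z else -1.

Lemma coord_1ps_normalized : normalized_1ps coord_1ps.
Proof.
split; last by exists ord0.
  move=> i j le_ij; rewrite /coord_1ps; case: (eqVneq j ord0) => [j0|_].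
    by rewrite ifT // -val_eqE -leqn0 /=; move: le_ij; rewrite j0.
  by case: ifP.
rewrite big_ord_recl /coord_1ps eqxx (eq_bigr (fun _ => -1)) //.
by rewrite sumr_const card_ord mulNrn -natz subrr.
Qed.

Lemma weight_coord_1ps (m : 'X_{1..n.+2}) :
  weight coord_1ps m = (m ord0)%:Z * n.+2%:Z - (mdeg m)%:Z.
Proof.
rewrite /weight mdegE big_ord_recl [in RHS]big_ord_recl /coord_1ps eqxx.
rewrite (eq_bigr (fun i => - (m (lift ord0 i))%:Z)); last first.
  by move=> i _; rewrite mulrN1.
rewrite sumrN PoszD (big_morph Posz PoszD (erefl _)) opprD addrA.
by congr (_ - _); lia.
Qed.

(** The iterated minimum starts from the leading monomial, which belongs to the
    support only because F is nonzero. *)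
Lemma le_min_weight r F w : F != 0 ->
  (forall m, m \in msupp F -> w <= weight r m) -> w <= min_weight r F.
Proof.
move=> F0 ge_w; rewrite /min_weight big_seq.
by apply: le_bigmin => [|m]; [exact/ge_w/mlead_supp | exact: ge_w].
Qed.

Lemma min_weight_coord_1ps d F : F != 0 -> F \is d.-homog ->
  - d%:Z <= min_weight coord_1ps F.
Proof.
move=> F0 /dhomogP Fd; apply: le_min_weight => // m mF.
by rewrite weight_coord_1ps (Fd _ mF); lia.
Qed.

(** Vanishing on x_0 = 0 gives m_0 >= 1 in every monomial m, which raises the
    general bound - d by n + 2. *)
Lemma min_weight_coord_1ps_vanish d F : F != 0 -> F \is d.-homog ->
  (forall x : 'cV[K]_n.+2, x 0 0 = 0 -> F.@[fun i => x i 0] = 0) ->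
  n.+2%:Z - d%:Z <= min_weight coord_1ps F.
Proof.
move=> F0 /dhomogP Fd Fx; apply: le_min_weight => // m mF.
rewrite weight_coord_1ps (Fd _ mF).
have [|_ /eqP-> m0] := @msupp_meets_zeros _ _ F (pred1 ord0) _ m mF; last by nia.
move=> x x0; rewrite (@meval_eq _ _ _ (fun i => (\col_j x j) i 0)).
  by apply: Fx; rewrite mxE; apply: x0.
by move=> i; rewrite mxE.
Qed.

End Weights.

(** * Pairs whose hypersurface contains a hyperplane *)

Section Destabilize.
Variables (K : closedFieldType) (n d : nat).
Implicit Types p q : hpair K n d.

Lemma eqX_homog p : mpoly_of_dhomog (eqX p) \is d.-homog.
Proof. exact: dhomog_is_dhomog. Qed.

Lemma eqH_homog p : mpoly_of_dhomog (eqH p) \is 1.-homog.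
Proof. exact: dhomog_is_dhomog. Qed.

Lemma act_eqX_neq0 g p : in_SL g -> act g (eqX p) != 0.
Proof.
move=> gSL; apply: contra (eqX_neq0 p) => /eqP/(act_eq0 gSL) p0.
exact/eqP/val_inj.
Qed.

Lemma act_eqH_neq0 g p : in_SL g -> act g (eqH p) != 0.
Proof.
move=> gSL; apply: contra (eqH_neq0 p) => /eqP/(act_eq0 gSL) p0.
exact/eqP/val_inj.
Qed.

(** One g serves both parts of the theorem: it straightens the hyperplane L
    contained in X, and H as well when H is that hyperplane. *)
Lemma contained_hyperplane_weights p (L : dhomog n.+2 K 1) :
  (0 < d)%N -> sub_Supp L (eqX p) ->
  exists2 g, in_SL g &
    n.+2%:Z - d%:Z <= min_weight (@coord_1ps n) (act g (eqX p)) /\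
    (eqH p = L -> n.+1%:Z <= min_weight (@coord_1ps n) (act g (eqH p))).
Proof.
move=> d_gt0 sLF.
have [g gSL Lg] := exists_SL_straighten (dhomog_is_dhomog L).
exists g => //; split=> [|eqHL].
  apply: min_weight_coord_1ps_vanish (act_eqX_neq0 _ gSL)
    (act_homog _ (eqX_homog p)) _.
  move=> x x0; rewrite meval_act.
  have [y0|yN0] := eqVneq (invmx g *m x) 0; last first.
    by case: (sLF (invmx g *m x)) => //; split=> //; apply: Lg.
  (* The origin is not a point of the support, but a form of positive degree
     vanishes there. *)
  rewrite y0 mevalE big_seq big1 // => m /(dhomogP _ _ _ (eqX_homog p)) /= md.
  have [i mi] : exists i, m i != 0%N.
    apply/existsP; apply: contraLR d_gt0 => /existsPn m0.
    rewrite -md mdegE big1 // => i _; apply/eqP; have := m0 i; by rewrite negbK.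
  by rewrite (bigD1 i) //= mxE expr0n (negPf mi) mul0r mulr0.
(* H has degree 1, so n + 1 is the bound n + 2 - d for d = 1. *)
have -> : n.+1%:Z = n.+2%:Z - 1%:Z by lia.
apply: min_weight_coord_1ps_vanish (act_eqH_neq0 _ gSL)
  (act_homog _ (eqH_homog p)) _.
by move=> x x0; rewrite meval_act eqHL; apply: Lg.
Qed.

Lemma orbit_sub_Supp p q : Defs.orbit p q ->
  sub_Supp (eqH q) (eqX q) -> sub_Supp (eqH p) (eqX p).
Proof.
case=> g [a] [b] [gSL [a0 _] -> ->] /(sub_SuppZ a0); exact: sub_Supp_act.
Qed.

Lemma semistable_not_sub_Supp t p : (0 < d <= n.+2)%N -> 0 < t ->
  semistable t p -> ~ sub_Supp (eqH p) (eqX p).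
Proof.
move=> /andP[d_gt0 le_d] t_gt0 ss /(contained_hyperplane_weights d_gt0)[g gSL [wX]].
move=> /(_ erefl) wH; have := ss g _ gSL (@coord_1ps_normalized n).
apply/negP; rewrite -ltNge /mu ltr_wpDl // ?mulr_gt0 // ?ler0z ?ltr0z; lia.
Qed.

Lemma contains_hyperplane_mu p : (0 < d)%N -> contains_hyperplane (eqX p) ->
  exists2 g, in_SL g & forall t, 0 <= t ->
    n.+2%:R - d%:R - t <= mu t (act g (eqX p)) (act g (eqH p)) (@coord_1ps n).
Proof.
move=> d_gt0 [L _ /(contained_hyperplane_weights d_gt0)[g gSL [wX _]]].
exists g => // t t_ge0; rewrite /mu -[- t]mulrN1 lerD // ?ler_wpM2l //.
  by rewrite -(ler_int rat) rmorphB in wX.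
have := min_weight_coord_1ps (act_eqH_neq0 p gSL) (act_homog _ (eqH_homog p)).
by rewrite -(ler_int rat) rmorphN.
Qed.

Lemma fano_weight_bound : (d <= n.+1)%N ->
  0 <= n.+2%:R - d%:R - t_crit n d.
Proof.
move=> le_d; rewrite /t_crit.
have -> : n.+2%:R - d%:R - d%:R / n.+1%:R =
   n.+2%:R * (n.+1%:R - d%:R) / n.+1%:R :> rat.
  by field; rewrite addrC natr1 pnatr_eq0.
by rewrite divr_ge0 ?mulr_ge0 ?ler0n // subr_ge0 ler_nat.
Qed.

End Destabilize.

Unset Implicit Arguments.
Set Strict Implicit.

(** * Stability of pairs *)

Theorem theorem1p3 (K : closedFieldType) (n d : nat)
    (hn : (1 <= n)%N) (hd : (1 < d)%N) :
  ((d <= n.+2)%N ->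
     forall t : rat, 0 < t ->
     forall O : hpair K n d -> Prop, GIT_quotient t O ->
     forall p, O p -> ~ sub_Supp (eqH p) (eqX p))
  /\
  ((d <= n.+1)%N ->
     forall t : rat, 0 <= t -> t <= t_crit n d ->
     forall p : hpair K n d, semistable t p ->
       (t <> t_crit n d -> ~ contains_hyperplane (eqX p)) /\
       (t = t_crit n d -> contains_hyperplane (eqX p) ->
          strictly_semistable (t_crit n d) p)).
Proof.
have d_gt0 : (0 < d)%N by apply: ltnW.
split=> [le_d t t_gt0 O [p0 [ss0 Oorb _]] p /Oorb orb_p | le_d t t_ge0 le_t p ss].
  move/(orbit_sub_Supp orb_p).
  by apply: semistable_not_sub_Supp ss0; rewrite ?d_gt0.
have bound := fano_weight_bound le_d.
split=> [/eqP neq_t /(contains_hyperplane_mu d_gt0)[g gSL /(_ t t_ge0) le_mu] | eq_t].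
  have := ss g _ gSL (@coord_1ps_normalized n).
  apply/negP; rewrite -ltNge; apply: lt_le_trans le_mu.
  apply: le_lt_trans bound _; rewrite ltrD2l ltrN2 lt_def le_t andbT eq_sym.
  exact: neq_t.
move=> /(contains_hyperplane_mu d_gt0)[g gSL /(_ t t_ge0) le_mu].
rewrite -eq_t in bound *; split=> // st.
have := st g _ gSL (@coord_1ps_normalized n).
by apply/negP; rewrite -leNgt; apply: le_trans le_mu.
Qed.
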